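(* Let $q$ be a prime power, let $\mathcal{C}$ be an $[n,k]_q$ code, and let $1\leq t\leq k$ be an integer. Then \[ R_t(\mathcal{C})\geq\left\lceil\left(1-\frac{1}{q^t}\right)d_t(\mathcal{C})-\sqrt{\frac{d_t(\mathcal{C})}{2}\,tk\ln q}\right\rceil.\]
   Context: An $[n,k]_q$ code $\mathcal{C}$ is a $k$-dimensional $\mathbb{F}_q$-linear subspace of $\mathbb{F}_q^n$. For a matrix $V\in\mathbb{F}_q^{t\times n}$, $\operatorname{wt}(V)$ is the number of non-zero columns of $V$, and $d(V,V')=\operatorname{wt}(V-V')$. $\mathcal{C}^t$ is the set of matrices in $\mathbb{F}_q^{t\times n}$ all of whose rows are in $\mathcal{C}$. For $1\leq t\leq k$, the $t$-th generalized Hamming weight is $d_t(\mathcal{C})=\min\{\operatorname{wt}(C): C\in\mathcal{C}^t,\ \operatorname{rank} C=t\}$. The $t$-th generalized covering radius is $R_t(\mathcal{C})=\max_{V\in\mathbb{F}_q^{t\times n}}\min_{C\in\mathcal{C}^t} d(V,C)$. *)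

(* Defs.v *)
From mathcomp Require Import all_boot all_order all_algebra.

Set Implicit Arguments.
Unset Strict Implicit.
Unset Printing Implicit Defensive.

Import GRing.Theory.
Local Open Scope ring_scope.

Section GeneralizedWeights.
Variables (F : finFieldType) (n : nat).

Definition wt (t : nat) (V : 'M[F]_(t, n)) : nat :=
  #|[set j : 'I_n | col j V != 0]|.

Definition hdist (t : nat) (V W : 'M[F]_(t, n)) : nat := wt (V - W).

Definition code_pow (C : {vspace 'rV[F]_n}) (t : nat) : {set 'M[F]_(t, n)} :=
  [set A : 'M[F]_(t, n) | [forall i, row i A \in C]].

(* In the two minima below, the neutral element n of the iterated minn does
   not affect the value when the range is nonempty, since wt is at most n.
   The range is nonempty in gen_weight when t <= \dim C, and always in
   cov_radius, since 0 \in code_pow C t. *)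
Definition gen_weight (C : {vspace 'rV[F]_n}) (t : nat) : nat :=
  \big[minn/n]_(A in code_pow C t | \rank A == t) wt A.

Definition cov_radius (C : {vspace 'rV[F]_n}) (t : nat) : nat :=
  (\max_(V : 'M[F]_(t, n)) \big[minn/n]_(A in code_pow C t) hdist V A)%N.

End GeneralizedWeights.

(* Main.v *)
Require Import Defs.
From mathcomp Require Import all_boot all_order all_algebra.
From mathcomp Require Import reals exp.
From mathcomp Require Import ring lra finfield.
From mathcomp Require Import topology normedtype sequences derive realfun.
From mathcomp Require Import boolp functions.

(* Union bound: for a uniformly random V, the distance from V to a fixed A is
   binomial with n trials of success probability 1 - q^-t, so by Hoeffding the
   fraction of V at distance below (1 - q^-t) n - s from A is at most
   exp(-2 s^2 / n). With s = sqrt(n/2 * t k ln q) this is q^-(tk), and there are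
   only q^(tk) matrices A in C^t, so some V is far from all of them. This gives
   the bound with n in place of d_t; since d_t <= n and d |-> a d - b sqrt d is
   increasing wherever it is positive, the bound with d_t follows. *)

Set Implicit Arguments.
Unset Strict Implicit.
Unset Printing Implicit Defensive.

Import Order.TTheory GRing.Theory Num.Theory numFieldNormedType.Exports.
Local Open Scope ring_scope.

(** * Calculus for the Bernoulli moment generating function *)

Lemma ge0_derive_ge (R : realType) (f df : R -> R) :
  (forall x : R, is_derive x 1 f (df x)) -> (forall x, 0 <= x -> 0 <= df x) ->
  forall x, 0 <= x -> f 0 <= f x.
Proof.
move=> fdf df_ge0 x x_ge0.
have [|c c0x fE] := MVT_segment x_ge0 (fun y _ => fdf y).
  apply: continuous_subspaceT => y.
  by apply: differentiable_continuous; apply/derivable1_diffP.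
rewrite -subr_ge0 fE subr0 mulr_ge0 // df_ge0 //.
by move: c0x; rewrite in_itv /= => /andP[].
Qed.

Section BernoulliMgf.
Variables (R : realType) (p : R).
Hypothesis p01 : 0 <= p < 1.

(** The moment generating function of a Bernoulli variable of mean [p]. It is used with [p] the
    probability that a uniform column is zero. *)
Let D (x : R) : R := 1 - p + p * expR x.

Let D_gt0 x : 0 < D x.
Proof.
by case/andP: p01 => p0 p1; rewrite ltr_pwDl ?subr_gt0 // mulr_ge0 ?expR_ge0.
Qed.

Let derive_D (x : R) : is_derive x 1 D (p * expR x).
Proof.
have -> : D = cst (1 - p) + p *: (expR : R -> R).
  by apply/funext.
have dD := is_deriveD (is_derive_cst (1 - p) x 1)
  (is_deriveZ p (is_derive_expR x)).
by apply: (is_derive_eq dD); rewrite add0r.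
Qed.

(** The tilted mean [u] starts at [p] and has derivative [u * (1 - u)], which never exceeds 1/4. *)
Lemma tilted_mean_le x : 0 <= x -> p * expR x / D x <= p + x / 4.
Proof.
move=> x0.
pose u y := 1 - (1 - p) / D y.
have uE y : p * expR y / D y = u y.
  by rewrite /u; have := D_gt0 y; rewrite /D => ?; field; lra.
pose Dinv : R -> R := fun y => (D y)^-1.
(* Up to a constant, [f] is [y / 4 - u y]; its derivative [1/4 - u * (1 - u)] is the square [df]. *)
pose f : R -> R := 4^-1 *: id + (1 - p) *: Dinv.
pose df y := (2^-1 - u y) ^+ 2.
have fdf (y : R) : is_derive y 1 f (df y).
  have D_neq0 : D y != 0 by rewrite gt_eqF.
  have dV : is_derive y 1 Dinv (- D y ^- 2 *: (p * expR y)).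
    exact: is_deriveV D_neq0 (derive_D y).
  have df' := is_deriveD (is_deriveZ 4^-1 (is_derive_id y 1))
    (is_deriveZ (1 - p) dV).
  apply: (is_derive_eq df').
  rewrite /df /u /GRing.scale /=.
  have -> : p * expR y = D y - (1 - p) by rewrite /D; ring.
  by field.
have := ge0_derive_ge fdf (fun y _ => sqr_ge0 _) x0.
rewrite uE /f /u /Dinv !fctE /GRing.scale /= /D expR0.
by rewrite mulr1 subrK divr1; lra.
Qed.

(* The derivative of ln (1 - p + p e^x) is the tilted mean. *)
Lemma bernoulli_mgf_le x :
  0 <= x -> 1 - p + p * expR x <= expR (p * x + x ^+ 2 / 8).
Proof.
move=> x0.
pose g : R -> R := - (p *: id + 8^-1 *: (id * id)).
have dg (y : R) : is_derive y 1 g (- (p + y / 4)).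
  have dsq := is_deriveM (is_derive_id y 1) (is_derive_id y 1).
  have d' := is_deriveN (is_deriveD (is_deriveZ p (is_derive_id y 1))
    (is_deriveZ 8^-1 dsq)).
  by apply: (is_derive_eq d'); rewrite /GRing.scale /=; field.
pose h : R -> R := expR \o g.
have dh (y : R) : is_derive y 1 h (h y * - (p + y / 4)).
  exact: is_derive1_comp (is_derive_expR (g y)) (dg y).
(* [h] is the reciprocal of the right-hand side, so [D * h] is the quotient of the two sides. It
   equals 1 at 0, and the tilted mean bound makes it nonincreasing; the sign turns this into growth
   of [f]. *)
pose f : R -> R := - (D * h).
pose df y := h y * D y * (p + y / 4 - p * expR y / D y).
have fdf (y : R) : is_derive y 1 f (df y).
  have D_neq0 : D y != 0 by rewrite gt_eqF.
  apply: (is_derive_eq (is_deriveN (is_deriveM (derive_D y) (dh y)))).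
  by rewrite /df /GRing.scale /=; field.
have df_ge0 y : 0 <= y -> 0 <= df y.
  move=> y0; rewrite mulr_ge0 ?subr_ge0 ?tilted_mean_le //.
  by rewrite mulr_ge0 ?expR_ge0 // ltW.
have := ge0_derive_ge fdf df_ge0 x0.
have f0 : f 0 = -1.
  rewrite /f /h /g !fctE /GRing.scale /= /D.
  by rewrite !(mulr0, addr0, oppr0, expR0); ring.
rewrite f0 /f !fctE lerN2 /h /= /g !fctE /GRing.scale /= expRN.
rewrite ler_pdivrMr ?expR_gt0 // mul1r /D.
by congr (_ <= expR _); field.
Qed.
End BernoulliMgf.

(** * Counting matrices by columns and by rows *)

(** This is the independence of the columns of a uniform matrix: a matrix is a free choice of
    columns, so the power of the sum expands into these products. *)
Lemma sum_prod_col (R : comPzSemiRingType) (F : finType) (t n : nat)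
    (f : 'cV[F]_t -> R) :
  \sum_(V : 'M[F]_(t, n)) \prod_j f (col j V) = (\sum_v f v) ^+ n.
Proof.
transitivity (\prod_(j < n) \sum_(v : 'cV[F]_t) f v); last first.
  by rewrite prodr_const card_ord.
rewrite bigA_distr_bigA /=.
pose cols (V : 'M[F]_(t, n)) := [ffun j => col j V].
pose mx_of (g : {ffun 'I_n -> 'cV[F]_t}) := \matrix_(i, j) g j i 0.
rewrite (reindex cols) /=.
  by apply: eq_bigr => V _; apply: eq_bigr => j _; rewrite ffunE.
exists mx_of => [V _|g _].
  by apply/matrixP => i j; rewrite !mxE ffunE mxE.
apply/ffunP => j; rewrite ffunE; apply/matrixP => i z.
by rewrite !mxE ord1.
Qed.

Lemma card_code_pow (F : finFieldType) (n t : nat) (C : {vspace 'rV[F]_n}) :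
  (#|code_pow C t| <= #|F| ^ (t * \dim C))%N.
Proof.
pose rows (A : 'M[F]_(t, n)) := [ffun i => row i A].
have rows_inj : injective rows.
  move=> A B /ffunP AB; apply/row_matrixP => i.
  by have := AB i; rewrite !ffunE.
rewrite -(card_imset _ rows_inj) mulnC expnM -(card_vspace C).
rewrite -[X in (_ <= _ ^ X)%N](card_ord t) -card_ffun_on.
apply/subset_leq_card/subsetP => _ /imsetP[A + ->].
rewrite inE => /forallP rowsC; apply/ffun_onP => i; rewrite ffunE; exact: rowsC.
Qed.

Lemma gen_weight_le (F : finFieldType) (n t : nat) (C : {vspace 'rV[F]_n}) :
  (gen_weight C t <= n)%N.
Proof.
apply: (big_ind (fun m => m <= n)%N) => // [a b an _|A _].
  by rewrite geq_min an.
by rewrite -[leqRHS]card_ord max_card.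
Qed.

(** * Chernoff bound on the size of a ball *)

Section ChernoffCount.
Variables (R : realType) (F : finFieldType) (n t : nat).
Hypothesis t_gt0 : (0 < t)%N.

Let Q : R := #|F|%:R ^+ t.

Let Q_gt1 : 1 < Q.
Proof. by rewrite /Q -natrX ltr1n -(exp1n t) ltn_exp2r // finNzRing_gt1. Qed.

(** The exponent counts zero columns, so the weight is a product over columns: [expR x] for the zero
    column, 1 for each of the [Q - 1] others. *)
Lemma sum_expR_zero_cols (x : R) :
  \sum_(V : 'M[F]_(t, n)) expR (x * (n%:R - (wt V)%:R))
  = (Q - 1 + expR x) ^+ n.
Proof.
pose f (v : 'cV[F]_t) : R := if v == 0 then expR x else 1.
transitivity (\sum_(V : 'M[F]_(t, n)) \prod_j f (col j V)).
  apply: eq_bigr => V _.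
  rewrite /f -big_mkcond /= prodr_const -expRM_natr; congr (expR (x * _)).
  apply/eqP; rewrite subr_eq -natrD eqr_nat -[eqbLHS]card_ord.
  rewrite -(cardC [set j | col j V != 0]) addnC; apply/eqP; congr addn.
  by apply: eq_card => j; rewrite !inE negbK.
rewrite sum_prod_col; congr (_ ^+ _).
rewrite (bigD1 0) //= /f eqxx addrC; congr (_ + _).
rewrite (eq_bigr (fun=> 1)) => [|v /negPf -> //].
rewrite sumr_const cardC1 card_mx muln1 /Q -natrX -subn1.
by rewrite natrB // expn_gt0 (ltnW (card_finNzRing_gt1 _)).
Qed.

(** Markov's inequality for the exponential weight: [V] lies in the ball exactly when [V - A] has
    more than [n / Q + y] zero columns. *)
Lemma card_ball_lt (A : 'M[F]_(t, n)) (x y : R) : 0 < x ->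
  #|[set V : 'M[F]_(t, n) | (hdist V A)%:R < (1 - Q^-1) * n%:R - y]|%:R
  < Q ^+ n * expR (n%:R * x ^+ 2 / 8 - x * y).
Proof.
move=> x0; set B := [set V | _].
have Q0 : 0 < Q by apply: lt_trans Q_gt1.
pose T := x * (n%:R / Q + y).
pose w (V : 'M[F]_(t, n)) : R := expR (x * (n%:R - (hdist V A)%:R)).
have sumw : \sum_V w V = (Q - 1 + expR x) ^+ n.
  rewrite -sum_expR_zero_cols (reindex (fun V => V + A)) /=.
    by apply: eq_bigr => V _; rewrite /w /hdist addrK.
  by exists (fun V => V - A) => V _; rewrite ?addrK ?subrK.
have wB V : V \in B -> expR T < w V.
  rewrite inE => VB; rewrite ltr_expR ltr_pM2l //.
  by move: VB; rewrite mulrBl mul1r [_^-1 * _]mulrC; lra.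
have w_ge0 V : 0 <= w V by rewrite expR_ge0.
have lt_sum : #|B|%:R * expR T < \sum_V w V.
  (* Strictness comes from a member of the ball, or, if it is empty, from the positive total
     weight. *)
  have [->|/set0Pn[V0 V0B]] := eqVneq B set0.
    rewrite cards0 mul0r sumw exprn_gt0 //.
    by rewrite addr_gt0 ?expR_gt0 // subr_gt0.
  apply: (@lt_le_trans _ _ (\sum_(V in B) w V)).
    rewrite mulr_natl -sumr_const; apply: ltr_sum => //.
    by apply/hasP; exists V0; rewrite ?mem_index_enum.
  by rewrite [leRHS](bigID [in B]) /= lerDl sumr_ge0.
have mgf : Q - 1 + expR x <= Q * expR (Q^-1 * x + x ^+ 2 / 8).
  have p01 : 0 <= Q^-1 < 1 by rewrite invr_ge0 ltW //= invf_lt1.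
  have := bernoulli_mgf_le p01 (ltW x0); rewrite -(ler_pM2l Q0).
  by rewrite mulrDr mulrBr mulr1 mulrA divff ?gt_eqF // mul1r.
rewrite -(ltr_pM2r (expR_gt0 T)); apply: lt_le_trans lt_sum _.
rewrite sumw -[leRHS]mulrA -expRD.
apply: le_trans (lerXn2r n _ _ mgf) _; rewrite ?nnegrE.
- by rewrite addr_ge0 ?expR_ge0 // subr_ge0 ltW.
- by rewrite mulr_ge0 ?expR_ge0 // ltW.
rewrite exprMn -expRM_natl ler_wpM2l ?exprn_ge0 ?(ltW Q0) // ler_expR /T.
by rewrite le_eqVlt; apply/orP; left; apply/eqP; field; rewrite gt_eqF.
Qed.
End ChernoffCount.

(** * The union bound and the passage from length to weight *)

Lemma exists_far_matrix (R : realType) (F : finFieldType) (n t : nat)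
    (C : {vspace 'rV[F]_n}) : (0 < t)%N -> (0 < \dim C)%N ->
  exists V : 'M[F]_(t, n), forall A, A \in code_pow C t ->
    (1 - (#|F|%:R ^+ t)^-1) * n%:R
    - Num.sqrt (n%:R / 2 * (t%:R * (\dim C)%:R * ln #|F|%:R))
    <= (hdist V A)%:R :> R.
Proof.
move=> t0 k0; set Q := _ ^+ t; set L : R := _ * ln _; set s := Num.sqrt _.
have n0 : 0 < n%:R :> R.
  rewrite ltr0n; apply: leq_trans k0 _.
  by have := dimvS (subvf C); rewrite dimvf dim_matrix mul1r.
have F1 : 1 < #|F|%:R :> R by rewrite ltr1n card_finNzRing_gt1.
have L0 : 0 < L by rewrite !mulr_gt0 ?ltr0n // ln_gt0.
have nL0 : 0 < n%:R / 2 * L by rewrite mulr_gt0 // divr_gt0.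
have s0 : 0 < s by rewrite sqrtr_gt0.
have s2 : s ^+ 2 = n%:R / 2 * L by rewrite sqr_sqrtr // ltW.
pose B A := [set V : 'M[F]_(t, n) | (hdist V A)%:R < (1 - Q^-1) * n%:R - s].
have cardB A : #|B A|%:R < Q ^+ n * expR (- L).
  (* This value of [x] minimises [n * x ^+ 2 / 8 - x * s]; the minimum is [- 2 * s ^+ 2 / n], that
     is [- L]. *)
  have x0 : 0 < 4 * s / n%:R by rewrite divr_gt0 // mulr_gt0.
  have := card_ball_lt t0 A s x0; congr (_ < _ * expR _).
  transitivity (- (2 * s ^+ 2 / n%:R)); first by field; rewrite gt_eqF.
  by rewrite s2; field; rewrite gt_eqF.
have expL : expR (- L) = (#|F|%:R ^+ (t * \dim C))^-1.
  rewrite expRN /L -natrM expRM_natl lnK // posrE.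
  exact: lt_trans F1.
have [V /forall_inP VP|noV] := pickP [pred V : 'M[F]_(t, n) |
    [forall (A | A \in code_pow C t), V \notin B A]].
  by exists V => A /VP; rewrite inE -leNgt.
(* From here on the balls are assumed to cover all [Q ^+ n] matrices. A nonempty index set keeps the
   sum of the strict ball bounds strict, which yields the contradiction. *)
have C0 : 0 \in code_pow C t.
  by rewrite inE; apply/forallP => i; rewrite row0 mem0v.
have cover : (#|{: 'M[F]_(t, n)}| <= \sum_(A in code_pow C t) #|B A|)%N.
  under eq_bigr => A _ do rewrite -sum1_card big_mkcond /=.
  rewrite exchange_big /= -sum1_card; apply: leq_sum => V _.
  have := noV V => /negbT/forall_inPn[A AC /negPn VA].
  by rewrite (bigD1 A) //= VA.
suff: Q ^+ n < Q ^+ n :> R by rewrite ltxx.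
rewrite [ltLHS](_ : _ = #|{: 'M[F]_(t, n)}|%:R); last first.
  by rewrite card_mx natrX exprM.
rewrite -(ler_nat R) natr_sum in cover; apply: le_lt_trans cover _.
apply: (@lt_le_trans _ _ (\sum_(A in code_pow C t) Q ^+ n * expR (- L))).
  apply: ltr_sum => [|A _]; last exact: cardB.
  by apply/hasP; exists 0 => //; rewrite mem_index_enum.
have Qn0 : 0 < Q ^+ n by rewrite !exprn_gt0 // (lt_trans _ F1).
rewrite sumr_const -mulr_natr expL -mulrA ger_pMr //.
rewrite ler_pdivrMl ?exprn_gt0 ?(lt_trans _ F1) // mulr1 -natrX ler_nat.
exact: card_code_pow.
Qed.

Theorem theorem20 (R : realType) (q n k t : nat) (F : finFieldType)
    (C : {vspace 'rV[F]_n}) (hq : #|F| = q) (hk : \dim C = k)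
    (ht : (1 <= t <= k)%N) :
  Num.ceil ((1 - 1 / q%:R ^+ t) * (gen_weight C t)%:R
            - Num.sqrt ((gen_weight C t)%:R / 2 * (t%:R * k%:R * ln q%:R)) :> R)
    <= (cov_radius C t)%:Z.
Proof.
case/andP: ht => t0 tk; rewrite ceil_le_int -{}hq -{k}hk in tk *.
set L := _ * ln _; rewrite div1r; set a := 1 - _; set d := gen_weight C t.
have [V Vfar] := exists_far_matrix R t0 (leq_trans t0 tk).
have R_ge : a * n%:R - Num.sqrt (n%:R / 2 * L) <= (cov_radius C t)%:R.
  apply: (@le_trans _ _ (\big[minn/n]_(A in code_pow C t) hdist V A)%:R).
    (* The default value [n] of the minimum must satisfy the bound too; it does because [a <= 1]. *)
    apply: (big_ind (fun m => _ <= m%:R)) => [|b c ? ?|A AC]; last exact: Vfar.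
      rewrite lerBlDr (le_trans (y := n%:R)) ?lerDl ?sqrtr_ge0 //.
      by rewrite ler_piMl // gerBl invr_ge0 exprn_ge0.
    by rewrite /minn; case: ifP.
  by rewrite ler_nat; exact: (leq_bigmax V).
have F1 : (1 <= #|F|)%N by exact: ltnW (card_finNzRing_gt1 _).
have L2 : 0 <= L / 2 by rewrite !mulr_ge0 ?invr_ge0 // ln_ge0 ?ler1n.
have sqrtE m : Num.sqrt (m%:R / 2 * L) = Num.sqrt m%:R * Num.sqrt (L / 2) :> R.
  by rewrite -sqrtrM ?ler0n // -mulrA [_^-1 * _]mulrC.
rewrite !sqrtE; set c := Num.sqrt (L / 2).
have dn : Num.sqrt d%:R <= Num.sqrt n%:R :> R.
  by rewrite ler_sqrt ?ler0n // ler_nat gen_weight_le.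
(* Both factors are nondecreasing in [m]. If the second is positive at [d], the product grows from
   [d] to [n]; otherwise the product at [d] is at most 0 and the claim is trivial. *)
have factor m : a * m%:R - Num.sqrt m%:R * c
    = Num.sqrt m%:R * (a * Num.sqrt m%:R - c) :> R.
  by rewrite -{1}[m%:R]sqr_sqrtr ?ler0n //; ring.
rewrite factor.
have [neg|pos] := lerP (a * Num.sqrt d%:R - c) 0.
  by apply: le_trans (ler0n _ _); rewrite mulr_ge0_le0 ?sqrtr_ge0.
apply: le_trans R_ge; rewrite sqrtE factor.
apply: ler_pM; rewrite ?sqrtr_ge0 ?(ltW pos) // lerD2r ler_wpM2l //.
by rewrite subr_ge0 invf_le1 ?exprn_gt0 ?ltr0n // ?exprn_ege1 ?ler1n.
Qed.
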